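(* Suppose $\lambda_1>0$ and $\beta$ satisfies condition $(E)$. Let $\varphi$ be an entire function and $C_\varphi f=f\circ\varphi$. Then $C_\varphi$ is a bounded operator from $\mathcal{H}(E,\beta)$ into itself if and only if $\varphi(z)=z+b$ for some $b\in\mathbb{C}$ with $\operatorname{Re}(b)\ge0$. Moreover, in that case the operator norm is $\|C_\varphi\|=e^{-\lambda_1\operatorname{Re}(b)}$.
   Context: Fix a sequence $\Lambda=(\lambda_n)_{n\ge1}$ of real numbers with $0\le\lambda_1<\lambda_2<\cdots$ and $\lambda_n\to+\infty$, such that $\limsup_{n\to\infty}\frac{\log n}{\lambda_n}<+\infty$. For a sequence $\beta=(\beta_n)$ of positive reals, condition $(E)$ is: $\liminf_{n\to\infty}\frac{\log\beta_n}{\lambda_n}=+\infty$. Under $(E)$, $\mathcal{H}(E,\beta)$ denotes the Hilbert space of entire functions $f(z)=\sum_{n=1}^\infty a_ne^{-\lambda_nz}$ ($a_n\in\mathbb{C}$; the representation is unique) with norm $\|f\|=\big(\sum_{n=1}^\infty|a_n|^2\beta_n^2\big)^{1/2}<\infty$. *)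

(* Defs.v *)
From Stdlib Require Import Reals.
Open Scope R_scope.

Definition Cplx : Type := (R * R)%type.
Definition Re (z : Cplx) : R := fst z.
Definition Im (z : Cplx) : R := snd z.
Definition Cadd (z w : Cplx) : Cplx := (fst z + fst w, snd z + snd w).
Definition Csub (z w : Cplx) : Cplx := (fst z - fst w, snd z - snd w).
Definition Cmul (z w : Cplx) : Cplx :=
  (fst z * fst w - snd z * snd w, fst z * snd w + snd z * fst w).
Definition Cmod (z : Cplx) : R := sqrt (fst z ^ 2 + snd z ^ 2).

Definition Cexp_neg (lam : R) (z : Cplx) : Cplx :=
  (exp (- lam * fst z) * cos (lam * snd z), - (exp (- lam * fst z) * sin (lam * snd z))).

Definition series_C (u : nat -> Cplx) (s : Cplx) : Prop :=
  infinite_sum (fun n => fst (u n)) (fst s) /\ infinite_sum (fun n => snd (u n)) (snd s).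

Definition entire (phi : Cplx -> Cplx) : Prop :=
  forall z : Cplx, exists L : Cplx, forall eps : R, 0 < eps -> exists delta : R, 0 < delta /\
    forall h : Cplx, 0 < Cmod h < delta ->
      Cmod (Csub (Csub (phi (Cadd z h)) (phi z)) (Cmul L h)) <= eps * Cmod h.

(* Standing assumptions on Lambda (indexed from 0: lam 0 = lambda_1). *)
Definition Lambda_ok (lam : nat -> R) : Prop :=
  0 <= lam 0%nat /\ (forall n, lam n < lam (S n)) /\ cv_infty lam /\
  exists K : R, exists N : nat, forall n : nat, (N <= n)%nat ->
    ln (INR (S n)) / lam n <= K.

Definition CondE (lam beta : nat -> R) : Prop :=
  (forall n, 0 < beta n) /\
  forall M : R, exists N : nat, forall n : nat, (N <= n)%nat -> M <= ln (beta n) / lam n.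

(* InH lam beta f a r : f belongs to H(E,beta), represented by the coefficient
   sequence a (f z = sum a_n e^{-lam_n z} for all z), with norm r. *)
Definition InH (lam beta : nat -> R) (f : Cplx -> Cplx) (a : nat -> Cplx) (r : R) : Prop :=
  (exists s : R, infinite_sum (fun n => (Cmod (a n)) ^ 2 * (beta n) ^ 2) s /\ r = sqrt s) /\
  forall z : Cplx, series_C (fun n => Cmul (a n) (Cexp_neg (lam n) z)) (f z).

Definition comp (f phi : Cplx -> Cplx) : Cplx -> Cplx := fun z => f (phi z).

Definition bounded_comp (lam beta : nat -> R) (phi : Cplx -> Cplx) : Prop :=
  exists M : R, forall (f : Cplx -> Cplx) (a : nat -> Cplx) (r : R), InH lam beta f a r ->
    exists (c : nat -> Cplx) (r' : R), InH lam beta (comp f phi) c r' /\ r' <= M * r.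

(* values ||C_phi f|| for ||f|| <= 1; the operator norm is its supremum *)
Definition opnorm_set (lam beta : nat -> R) (phi : Cplx -> Cplx) (t : R) : Prop :=
  exists (f : Cplx -> Cplx) (a : nat -> Cplx) (r : R) (c : nat -> Cplx),
    InH lam beta f a r /\ r <= 1 /\ InH lam beta (comp f phi) c t.

(* Main.v *)
(** The reproducing kernels K_w have squared norm k(Re w) = sum e^{-2 lam_n Re w} / beta_n^2,
    and k(x - h) >= e^{2 lam_0 h} k(x) for h >= 0.  Evaluating K_{phi w} o phi at w gives
    k(Re phi w) <= M^2 k(Re w) when C_phi has norm at most M, hence Re phi(w) >= Re w - h
    for some constant h.  Therefore F = e^{-lam_0 phi}, which is again a Dirichlet series
    sum c_n e^{-lam_n z}, satisfies |F(z)| <= C e^{-lam_0 Re z} on the whole plane.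
    Since |c_n| e^{-lam_n x} <= sup_y |F(x + iy)|, letting x -> -oo kills all c_n
    with n > 0, so Re (phi(z) - z) is constant, and so is phi(z) - z.  The coefficient bound
    comes from averaging F over vertical shifts that cancel the other frequencies one at
    a time; it also gives the uniqueness of the coefficients, from which Re b >= 0 and the
    operator norm are read off on monomials. *)

From Stdlib Require Import Reals Lra Lia.
Require Import Defs.
From Coquelicot Require Import Rcomplements Rbar Hierarchy Lim_seq Series Derive Complex.
Open Scope R_scope.

(* [Cplx] and its operations in [Defs] are convertible to Coquelicot's [C], used from here
   on; [Re], [Im] and [Cmod] are Coquelicot's until [Defs] is imported again. *)

Lemma exp_le (x y : R) : x <= y -> exp x <= exp y.
Proof. intros [Hlt | ->]; [left; now apply exp_increasing | apply Rle_refl]. Qed.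

Lemma exp_sqr (x : R) : exp x ^ 2 = exp (2 * x).
Proof. replace (2 * x) with (x + x) by ring; rewrite exp_plus; ring. Qed.

Lemma strictly_increasing_seq_lt (u : nat -> R) (m n : nat) :
  (forall k, u k < u (S k)) -> (m < n)%nat -> u m < u n.
Proof.
  intros Hstep; induction 1 as [|n Hmn IH]; [apply Hstep | pose proof (Hstep n); lra].
Qed.

Lemma norm_is_series_le {K : AbsRing} {V : NormedModule K} (a : nat -> V) (b : nat -> R)
    (la : V) (lb : R) :
  is_series a la -> is_series b lb -> (forall n, norm (a n) <= b n) -> norm la <= lb.
Proof.
  intros Ha Hb Hab.
  apply (is_lim_seq_le (fun n => norm (sum_n a n)) (sum_n b) (norm la) lb).
  - intros n; eapply Rle_trans; [apply norm_sum_n_m|]; now apply sum_n_m_le.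
  - apply (filterlim_comp _ _ _ (sum_n a) norm _ _ _ Ha), filterlim_norm.
  - exact Hb.
Qed.

Lemma is_series_inj {K : AbsRing} {V : NormedModule K} (a : nat -> V) (l1 l2 : V) :
  is_series a l1 -> is_series a l2 -> l1 = l2.
Proof. apply filterlim_locally_unique. Qed.

Lemma is_series_eventually {K : AbsRing} {V : NormedModule K} (a : nat -> V) (l : V) (N : nat) :
  (forall n, (N <= n)%nat -> sum_n a n = l) -> is_series a l.
Proof.
  intros Hsum; apply filterlim_ext_loc with (f := fun _ => l); [|apply filterlim_const].
  exists N; intros n Hn; now rewrite Hsum.
Qed.

Lemma is_series_single {K : AbsRing} {V : NormedModule K} (a : nat -> V) (m : nat) (l : V) :
  a m = l -> (forall n, n <> m -> a n = zero) -> is_series a l.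
Proof.
  intros <- Hzero; apply is_series_eventually with m; intros n Hn.
  induction Hn as [|n Hn IH].
  - destruct m as [|m]; [apply sum_O|].
    rewrite sum_Sn, (sum_n_ext_loc _ (fun _ => zero)) by (intros; apply Hzero; lia).
    now unfold sum_n; rewrite sum_n_m_const_zero, plus_zero_l.
  - rewrite sum_Sn, IH, (Hzero (S n)) by lia; apply plus_zero_r.
Qed.

Lemma is_series_tail {K : AbsRing} {V : NormedModule K} (a : nat -> V) (l : V) (N : nat) :
  is_series a l ->
  is_series (fun n => if (n <=? N)%nat then zero else a n) (minus l (sum_n a N)).
Proof.
  intros Ha.
  assert (Hhead : is_series (fun n => if (n <=? N)%nat then a n else zero) (sum_n a N)).
  { apply is_series_eventually with N; intros n Hn.
    induction Hn as [|n Hn IH].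
    - apply sum_n_ext_loc; intros k Hk; now rewrite (proj2 (Nat.leb_le k N) Hk).
    - rewrite sum_Sn, IH, (proj2 (Nat.leb_gt (S n) N)) by lia; apply plus_zero_r. }
  eapply is_series_ext; [|apply (is_series_minus _ _ _ _ Ha Hhead)].
  intros n; simpl; destruct ((n <=? N)%nat); [apply (plus_opp_r (a n))|].
  apply (minus_zero_r (a n)).
Qed.

Lemma ex_series_mult_of_sqr (a b : nat -> R) :
  ex_series (fun n => a n ^ 2) -> ex_series (fun n => b n ^ 2) -> ex_series (fun n => a n * b n).
Proof.
  intros Ha Hb.
  apply @ex_series_le with (b := fun n => a n ^ 2 + b n ^ 2); [|exact (ex_series_plus _ _ Ha Hb)].
  intros n; apply Rabs_le.
  pose proof (pow2_ge_0 (a n + b n)); pose proof (pow2_ge_0 (a n - b n)); nra.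
Qed.

Lemma nonneg_quadratic_discriminant (p q r : R) :
  0 <= r -> (forall t, 0 <= p - 2 * t * q + t ^ 2 * r) -> q ^ 2 <= p * r.
Proof.
  intros [Hr | <-] Hnonneg.
  - specialize (Hnonneg (q / r)).
    replace (p - 2 * (q / r) * q + (q / r) ^ 2 * r) with ((p * r - q ^ 2) / r) in Hnonneg
      by (field; lra).
    apply Rle_div_r in Hnonneg; lra.
  - destruct (Req_dec q 0) as [->|Hq]; [lra|].
    specialize (Hnonneg ((p + 1) / (2 * q))).
    replace (p - _ + _) with (-1) in Hnonneg by (field; assumption); lra.
Qed.

Lemma Series_nonneg (a : nat -> R) : (forall n, 0 <= a n) -> ex_series a -> 0 <= Series a.
Proof.
  intros Hpos Ha; rewrite <- (Rmult_0_l (Series a)), <- Series_scal_l.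
  apply Series_le; [intros n; specialize (Hpos n); lra | assumption].
Qed.

Lemma Series_cauchy_schwarz (a b : nat -> R) :
  ex_series (fun n => a n ^ 2) -> ex_series (fun n => b n ^ 2) ->
  Series (fun n => a n * b n) ^ 2 <= Series (fun n => a n ^ 2) * Series (fun n => b n ^ 2).
Proof.
  intros Ha Hb; pose proof (ex_series_mult_of_sqr a b Ha Hb) as Hab.
  apply nonneg_quadratic_discriminant;
    [apply Series_nonneg; [intros n; apply pow2_ge_0 | assumption]|].
  intros t.
  pose proof (is_series_plus _ _ _ _
    (is_series_minus _ _ _ _ (Series_correct _ Ha)
      (is_series_scal (2 * t) _ _ (Series_correct _ Hab)))
    (is_series_scal (t ^ 2) _ _ (Series_correct _ Hb))) as Hsum.
  assert (Hsqr : is_series (fun n => (a n - t * b n) ^ 2) (Series (fun n => a n ^ 2)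
      - 2 * t * Series (fun n => a n * b n) + t ^ 2 * Series (fun n => b n ^ 2))).
  { revert Hsum; apply is_series_ext; intros n.
    unfold plus, opp, scal; simpl; unfold mult; simpl; ring. }
  rewrite <- (is_series_unique _ _ Hsqr).
  apply Series_nonneg; [intros n; apply pow2_ge_0 | eexists; exact Hsqr].
Qed.

Lemma is_series_telescope (u : nat -> R) (l : R) :
  is_lim_seq u l -> is_series (fun n => u n - u (S n)) (u 0%nat - l).
Proof.
  intros Hu.
  change (is_lim_seq (sum_n (fun n => u n - u (S n))) (u 0%nat - l)).
  apply is_lim_seq_ext with (fun n => u 0%nat - u (S n)).
  - induction n as [|n IH]; [now rewrite sum_O|].
    rewrite sum_Sn, <- IH; unfold plus; simpl; ring.
  - apply is_lim_seq_minus'; [apply is_lim_seq_const|].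
    now apply (is_lim_seq_incr_1 u).
Qed.

Lemma ex_series_inv_sqr : ex_series (fun n => / INR (S n) ^ 2).
Proof.
  set (telescoping := fun n => / INR (S n) - / INR (S (S n))).
  apply @ex_series_le with (b := fun n => 2 * telescoping n).
  - intros n; change (Rabs (/ INR (S n) ^ 2) <= 2 * telescoping n); unfold telescoping.
    rewrite (S_INR (S n)); pose proof (pos_INR n); pose proof (S_INR n).
    set (t := INR (S n)) in *.
    rewrite Rabs_pos_eq by (left; apply Rinv_0_lt_compat; nra).
    replace (2 * (/ t - / (t + 1))) with (2 * / (t * (t + 1))) by (field; lra).
    replace (/ t ^ 2) with (2 * / (2 * t ^ 2)) by (field; lra).
    apply Rmult_le_compat_l; [lra|apply Rinv_le_contravar; nra].
  - apply (ex_series_scal 2 telescoping); eexists.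
    apply (is_series_telescope (fun n => / INR (S n)) 0).
    apply (is_lim_seq_incr_1 (fun n => / INR n)).
    apply (is_lim_seq_inv INR p_infty is_lim_seq_INR); discriminate.
Qed.

Lemma is_series_C_iff (u : nat -> C) (s : C) :
  is_series u s <->
  is_series (fun n => Re (u n)) (Re s) /\ is_series (fun n => Im (u n)) (Im s).
Proof.
  assert (Hre : forall n, Re (sum_n u n) = sum_n (fun k => Re (u k)) n).
  { induction n as [|n IH]; [now rewrite !sum_O | now rewrite !sum_Sn, <- IH]. }
  assert (Him : forall n, Im (sum_n u n) = sum_n (fun k => Im (u k)) n).
  { induction n as [|n IH]; [now rewrite !sum_O | now rewrite !sum_Sn, <- IH]. }
  split.
  - intros Hu; split; intros P [eps HP].
    + destruct (Hu (fun z => P (Re z))) as [N HN]; [exists eps; intros z [Hz _]; now apply HP|].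
      exists N; intros n Hn; rewrite <- Hre; now apply HN.
    + destruct (Hu (fun z => P (Im z))) as [N HN]; [exists eps; intros z [_ Hz]; now apply HP|].
      exists N; intros n Hn; rewrite <- Him; now apply HN.
  - intros [Hur Hui] P [eps HP].
    destruct (Hur _ (locally_ball _ eps)) as [N1 HN1].
    destruct (Hui _ (locally_ball _ eps)) as [N2 HN2].
    exists (N1 + N2)%nat; intros n Hn; apply HP; split.
    + change (ball (Re s) eps (Re (sum_n u n))); rewrite Hre; apply HN1; lia.
    + change (ball (Im s) eps (Im (sum_n u n))); rewrite Him; apply HN2; lia.
Qed.

Lemma series_C_is_series (u : nat -> C) (s : C) : series_C u s <-> is_series u s.
Proof. rewrite is_series_C_iff; unfold series_C; rewrite <- !is_series_Reals; tauto. Qed.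

Definition Cseries (u : nat -> C) : C :=
  (Series (fun n => Re (u n)), Series (fun n => Im (u n))).

Lemma Cseries_correct (u : nat -> C) :
  ex_series (fun n => Cmod (u n)) -> is_series u (Cseries u).
Proof.
  intros Hu; destruct (ex_series_le u _ (fun n => Rle_refl _) Hu) as [s Hs].
  apply is_series_C_iff in Hs as [Hre Him].
  apply is_series_C_iff; split; apply Series_correct; eexists; eassumption.
Qed.

Lemma Cmod_half_plus_le (u v : C) (B : R) :
  Cmod u <= B -> Cmod v <= B -> Cmod (/ 2 * (u + v)) <= B.
Proof.
  intros Hu Hv; rewrite Cmod_mult, <- RtoC_inv, Cmod_R, Rabs_pos_eq by lra.
  pose proof (Cmod_triangle u v); lra.
Qed.

Lemma Cmod_Cexp_neg (l : R) (z : C) : Cmod (Cexp_neg l z) = exp (- l * Re z).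
Proof.
  transitivity (sqrt (exp (- l * Re z) ^ 2)); [|apply sqrt_pow2; left; apply exp_pos].
  unfold Cmod; f_equal.
  pose proof (sin2_cos2 (l * Im z)) as Htrig; unfold Rsqr in Htrig.
  unfold Re, Im in *; simpl; nra.
Qed.

Lemma Cexp_neg_plus (l : R) (z w : C) :
  Cexp_neg l (z + w)%C = (Cexp_neg l z * Cexp_neg l w)%C.
Proof.
  unfold Cexp_neg, Cplus, Cmult; simpl.
  rewrite !Rmult_plus_distr_l, exp_plus, cos_plus, sin_plus; f_equal; ring.
Qed.

Lemma Cexp_neg_minus_l (l m : R) (z : C) :
  Cexp_neg (l - m) z = (Cexp_neg l z * Cexp_neg m (- z))%C.
Proof.
  unfold Cexp_neg, Copp, Cmult; simpl.
  replace (- (l - m) * fst z) with (- l * fst z + - m * - fst z) by ring.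
  replace (m * - snd z) with (- (m * snd z)) by ring.
  rewrite Rmult_minus_distr_r, exp_plus, cos_minus, sin_minus, cos_neg, sin_neg; f_equal; ring.
Qed.

Lemma Cexp_neg_0_l (z : C) : Cexp_neg 0 z = 1 :> C.
Proof.
  unfold Cexp_neg, RtoC; rewrite Ropp_0, !Rmult_0_l, exp_0, cos_0, sin_0; f_equal; ring.
Qed.

Lemma Cexp_neg_0_r (l : R) : Cexp_neg l (RtoC 0) = 1 :> C.
Proof.
  unfold Cexp_neg, RtoC; simpl; rewrite !Rmult_0_r, exp_0, cos_0, sin_0; f_equal; ring.
Qed.

Lemma Cmod_Cexp_neg_imaginary (l y : R) : Cmod (Cexp_neg l (0, y)) = 1.
Proof. rewrite Cmod_Cexp_neg; simpl; rewrite Rmult_0_r; apply exp_0. Qed.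

Section Dirichlet.

Variable lam : nat -> R.

Definition dirichlet (c : nat -> C) (F : C -> C) : Prop :=
  forall z : C, is_series (fun n => c n * Cexp_neg (lam n) z)%C (F z).

Lemma dirichlet_plus (c d : nat -> C) (F G : C -> C) :
  dirichlet c F -> dirichlet d G ->
  dirichlet (fun n => c n + d n)%C (fun z => F z + G z)%C.
Proof.
  intros HF HG z; generalize (is_series_plus _ _ _ _ (HF z) (HG z)).
  apply is_series_ext; intros n; symmetry; apply Cmult_plus_distr_r.
Qed.

Lemma dirichlet_scal (k : C) (c : nat -> C) (F : C -> C) :
  dirichlet c F -> dirichlet (fun n => k * c n)%C (fun z => k * F z)%C.
Proof.
  intros HF z; generalize (is_series_scal k _ _ (HF z)).
  apply is_series_ext; intros n; apply Cmult_assoc.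
Qed.

Lemma dirichlet_shift (c : nat -> C) (F : C -> C) (w : C) :
  dirichlet c F ->
  dirichlet (fun n => c n * Cexp_neg (lam n) w)%C (fun z => F (z + w)%C).
Proof.
  intros HF z; generalize (HF (z + w)%C).
  apply is_series_ext; intros n.
  rewrite Cexp_neg_plus, (Cmult_comm (Cexp_neg _ z)); apply Cmult_assoc.
Qed.

Lemma dirichlet_ext (c d : nat -> C) (F G : C -> C) :
  (forall n, c n = d n) -> (forall z, F z = G z) -> dirichlet c F -> dirichlet d G.
Proof.
  intros Hcd HFG HF z; rewrite <- HFG.
  generalize (HF z); apply is_series_ext; intros n; now rewrite Hcd.
Qed.

Definition monomial (m : nat) (k : C) : C -> C := fun z => (k * Cexp_neg (lam m) z)%C.

Definition monomial_coeff (m : nat) (k : C) : nat -> C :=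
  fun n => if Nat.eq_dec n m then k else 0.

Lemma monomial_coeff_eq (m : nat) (k : C) : monomial_coeff m k m = k.
Proof. unfold monomial_coeff; now destruct (Nat.eq_dec m m). Qed.

Lemma monomial_coeff_neq (m n : nat) (k : C) : n <> m -> monomial_coeff m k n = 0.
Proof. intros Hn; unfold monomial_coeff; now destruct (Nat.eq_dec n m). Qed.

Lemma dirichlet_monomial (m : nat) (k : C) : dirichlet (monomial_coeff m k) (monomial m k).
Proof.
  intros z; apply is_series_single with m; [now rewrite monomial_coeff_eq|].
  intros n Hn; rewrite monomial_coeff_neq by assumption; apply Cmult_0_l.
Qed.

Lemma dirichlet_average (c : nat -> C) (F : C -> C) (m : nat) (w : C) :
  dirichlet c F ->
  dirichlet (fun n => / 2 * (c n + c n * Cexp_neg (lam n - lam m) w))%C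
    (fun z => / 2 * (F z + Cexp_neg (lam m) (- w) * F (z + w)))%C.
Proof.
  intros HF; apply dirichlet_scal.
  apply (dirichlet_ext (fun n => c n + Cexp_neg (lam m) (- w) * (c n * Cexp_neg (lam n) w))%C)
    with (fun z => F z + Cexp_neg (lam m) (- w) * F (z + w))%C; [|reflexivity|].
  - intros n; rewrite Cexp_neg_minus_l; ring.
  - apply dirichlet_plus, dirichlet_scal, dirichlet_shift; assumption.
Qed.

(* Averaging over the shift [i tau], [tau = PI / (lam_N - lam_m)], multiplies the n-th
   coefficient by [(1 + e^{-i (lam_n - lam_m) tau}) / 2], which is 1 at n = m and 0 at n = N. *)
Lemma dirichlet_cancel_coeff (c : nat -> C) (F : C -> C) (m N : nat) (B : R) :
  lam N <> lam m -> dirichlet c F -> (forall y, Cmod (F (0, y)) <= B) ->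
  exists (c' : nat -> C) (F' : C -> C),
    dirichlet c' F' /\ (forall y, Cmod (F' (0, y)) <= B) /\
    c' m = c m /\ c' N = 0 /\ (forall n, Cmod (c' n) <= Cmod (c n)).
Proof.
  intros Hne HF HB.
  set (tau := PI / (lam N - lam m)).
  set (e := (fun n => Cexp_neg (lam n - lam m) (0, tau)) : nat -> C).
  assert (Hem : e m = 1) by (unfold e; rewrite Rminus_diag; apply Cexp_neg_0_l).
  assert (HeN : e N = (- (1))%C).
  { unfold e, Cexp_neg, RtoC, Copp; simpl.
    replace ((lam N - lam m) * tau) with PI by (unfold tau; field; lra).
    rewrite Rmult_0_r, cos_PI, sin_PI, exp_0; f_equal; ring. }
  do 2 eexists; split; [exact (dirichlet_average c F m (0, tau) HF)|].
  fold e; repeat split.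
  - intros y; apply Cmod_half_plus_le; [apply HB|].
    unfold Copp, Cplus; simpl; rewrite Ropp_0, Rplus_0_r.
    rewrite Cmod_mult, Cmod_Cexp_neg_imaginary, Rmult_1_l; apply HB.
  - change (/ 2 * (c m + c m * e m) = c m)%C; rewrite Hem; field.
  - change (/ 2 * (c N + c N * e N) = 0)%C; rewrite HeN; ring.
  - intros n; apply Cmod_half_plus_le; [apply Rle_refl|].
    rewrite Cmod_mult, Cmod_Cexp_neg_imaginary, Rmult_1_r; apply Rle_refl.
Qed.

Hypothesis lam_inj : forall m n, n <> m -> lam n <> lam m.

(* Induction on N, cancelling the N-th coefficient. *)
Lemma dirichlet_coeff_le_tail (m : nat) (B : R) (v : nat -> R) (V : R) (N : nat) :
  (forall n, 0 <= v n) -> is_series v V ->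
  forall (c : nat -> C) (F : C -> C), dirichlet c F ->
  (forall y, Cmod (F (0, y)) <= B) ->
  (forall n, (N <= n)%nat -> n <> m -> Cmod (c n) <= v n) -> Cmod (c m) <= B + V.
Proof.
  intros Hv HV; induction N as [|N IH]; intros c F HF HB Hc.
  - assert (Hmono : monomial m (c m) 0 = c m)
      by (unfold monomial; rewrite Cexp_neg_0_r; apply Cmult_1_r).
    assert (Hrest : Cmod (F 0 - c m) <= V).
    { rewrite <- Hmono.
      apply (norm_is_series_le _ _ _ _
        (is_series_minus _ _ _ _ (HF 0) (dirichlet_monomial m (c m) 0)) HV); intros n.
      change (Cmod (c n * Cexp_neg (lam n) (RtoC 0)
                    - monomial_coeff m (c m) n * Cexp_neg (lam n) (RtoC 0)) <= v n).
      rewrite Cexp_neg_0_r, !Cmult_1_r; destruct (Nat.eq_dec n m) as [->|Hnm].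
      - rewrite monomial_coeff_eq; replace (c m - c m)%C with (RtoC 0) by ring.
        rewrite Cmod_0; apply Hv.
      - rewrite monomial_coeff_neq by assumption.
        replace (c n - 0)%C with (c n) by ring; apply Hc; [lia | assumption]. }
    pose proof (Cmod_triangle (F 0) (- (F 0 - c m))%C) as Htri.
    replace (F 0 + _)%C with (c m) in Htri by ring.
    rewrite Cmod_opp in Htri; assert (Cmod (F 0) <= B) by exact (HB 0); lra.
  - destruct (Nat.eq_dec N m) as [->|HNm].
    + apply (IH c F HF HB); intros n Hn Hnm; apply Hc; lia.
    + destruct (dirichlet_cancel_coeff c F m N B (lam_inj m N HNm) HF HB)
        as (c' & F' & HF' & HB' & Hm & HN & Hle).
      rewrite <- Hm; apply (IH c' F' HF' HB'); intros n Hn Hnm.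
      destruct (Nat.eq_dec n N) as [->|HnN]; [rewrite HN, Cmod_0; apply Hv|].
      eapply Rle_trans; [apply Hle | apply Hc; lia].
Qed.

Lemma dirichlet_coeff_le_sup (c : nat -> C) (F : C -> C) (m : nat) (B : R) :
  dirichlet c F -> ex_series (fun n => Cmod (c n)) ->
  (forall y, Cmod (F (0, y)) <= B) -> Cmod (c m) <= B.
Proof.
  intros HF [total Htotal] HB; apply le_epsilon; intros eps Heps.
  assert (Hlim : is_lim_seq (sum_n (fun n => Cmod (c n))) total) by exact Htotal.
  apply is_lim_seq_spec in Hlim; destruct (Hlim (mkposreal eps Heps)) as [N HN].
  specialize (HN N (le_n N)); apply Rabs_lt_between' in HN; simpl in HN.
  apply Rle_trans with (B + minus total (sum_n (fun n => Cmod (c n)) N));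
    [|unfold minus, plus, opp; simpl; lra].
  apply (dirichlet_coeff_le_tail m B
    (fun n => if (n <=? N)%nat then zero else Cmod (c n)) _ (S N)) with (c := c) (F := F);
    try assumption.
  - intros n; destruct ((n <=? N)%nat); [apply Rle_refl | apply Cmod_ge_0].
  - exact (is_series_tail _ _ N Htotal).
  - intros n Hn _; rewrite (proj2 (Nat.leb_gt n N)) by lia; apply Rle_refl.
Qed.

Lemma dirichlet_coeff_le (c : nat -> C) (F : C -> C) (m : nat) (x B : R) :
  dirichlet c F ->
  ex_series (fun n => Cmod (c n) * exp (- lam n * x)) ->
  (forall y, Cmod (F (x, y)) <= B) -> Cmod (c m) * exp (- lam m * x) <= B.
Proof.
  intros HF Habs HB.
  assert (Hmod : forall n, Cmod (c n * Cexp_neg (lam n) (x, 0)) = Cmod (c n) * exp (- lam n * x))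
    by (intros n; now rewrite Cmod_mult, Cmod_Cexp_neg).
  rewrite <- Hmod.
  apply (dirichlet_coeff_le_sup _ _ m B (dirichlet_shift c F (x, 0) HF)).
  - revert Habs; apply ex_series_ext; intros n; now rewrite Hmod.
  - intros y; unfold Cplus; simpl; rewrite Rplus_0_l, Rplus_0_r; apply HB.
Qed.

Lemma dirichlet_unique (c d : nat -> C) (F : C -> C) (m : nat) :
  dirichlet c F -> dirichlet d F ->
  ex_series (fun n => Cmod (c n)) -> ex_series (fun n => Cmod (d n)) -> c m = d m.
Proof.
  intros Hc Hd Hcabs Hdabs.
  assert (Hle : Cmod (c m + - (1) * d m) <= 0).
  { apply (dirichlet_coeff_le_sup (fun n => c n + - (1) * d n)%C
      (fun z => F z + - (1) * F z)%C m).
    - now apply dirichlet_plus, dirichlet_scal.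
    - apply @ex_series_le with (b := fun n => Cmod (c n) + Cmod (d n));
        [|exact (ex_series_plus _ _ Hcabs Hdabs)].
      intros n; change norm with Rabs; rewrite Rabs_pos_eq by apply Cmod_ge_0.
      eapply Rle_trans; [apply Cmod_triangle|].
      rewrite Cmod_mult, Cmod_m1; lra.
    - intros y; replace (F (0, y) + - (1) * F (0, y))%C with (RtoC 0) by ring.
      rewrite Cmod_0; apply Rle_refl. }
  pose proof (Cmod_ge_0 (c m + - (1) * d m)).
  assert (Heq : (c m + - (1) * d m)%C = 0) by (apply Cmod_eq_0; lra).
  replace (c m) with (c m + - (1) * d m + d m)%C by ring; rewrite Heq; ring.
Qed.

Lemma dirichlet_liouville (c : nat -> C) (F : C -> C) (m : nat) (l h : R) :
  dirichlet c F ->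
  (forall x, ex_series (fun n => Cmod (c n) * exp (- lam n * x))) ->
  (forall z, Cmod (F z) <= exp (h - l * Re z)) -> l < lam m -> c m = 0.
Proof.
  intros HF Habs Hgrowth Hl; apply Cmod_eq_0.
  destruct (Cmod_ge_0 (c m)) as [Hpos|]; [exfalso|now symmetry].
  set (x := (ln (Cmod (c m)) - h - 1) / (lam m - l)).
  assert (Hx : (lam m - l) * x = ln (Cmod (c m)) - h - 1) by (unfold x; field; lra).
  assert (Hle : Cmod (c m) * exp (- lam m * x) <= exp (h - l * x))
    by exact (dirichlet_coeff_le c F m x (exp (h - l * x)) HF (Habs x) (fun y => Hgrowth (x, y))).
  rewrite <- (exp_ln (Cmod (c m))), <- exp_plus in Hle by assumption.
  apply Rle_not_lt in Hle; apply Hle, exp_increasing; lra.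
Qed.

End Dirichlet.

Section WeightedSpace.

Variables lam beta : nat -> R.
Hypothesis lam_ok : Lambda_ok lam.
Hypothesis beta_E : CondE lam beta.

Lemma lam_increasing (m n : nat) : (m < n)%nat -> lam m < lam n.
Proof. destruct lam_ok as (_ & Hstep & _); now apply strictly_increasing_seq_lt. Qed.

Lemma lam_inj (m n : nat) : n <> m -> lam n <> lam m.
Proof.
  intros [Hlt | Hlt]%Nat.lt_gt_cases; apply lam_increasing in Hlt; lra.
Qed.

Lemma lam_0_le (n : nat) : lam 0%nat <= lam n.
Proof. destruct n as [|n]; [lra | left; apply lam_increasing; lia]. Qed.

Lemma beta_pos (n : nat) : 0 < beta n.
Proof. apply beta_E. Qed.

Definition weighted_l2 (a : nat -> C) : Prop := ex_series (fun n => (Cmod (a n) * beta n) ^ 2).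

Definition weighted_norm (a : nat -> C) : R := sqrt (Series (fun n => (Cmod (a n) * beta n) ^ 2)).

Lemma weighted_norm_sqr (a : nat -> C) :
  weighted_l2 a -> weighted_norm a ^ 2 = Series (fun n => (Cmod (a n) * beta n) ^ 2).
Proof.
  intros Ha; apply pow2_sqrt, Series_nonneg; [intros n; apply pow2_ge_0 | exact Ha].
Qed.

Lemma InH_iff (f : C -> C) (a : nat -> C) (r : R) :
  InH lam beta f a r <-> weighted_l2 a /\ r = weighted_norm a /\ dirichlet lam a f.
Proof.
  assert (Hterm : forall n, Cmod (a n) ^ 2 * beta n ^ 2 = (Cmod (a n) * beta n) ^ 2)
    by (intros n; symmetry; apply Rpow_mult_distr).
  split.
  - intros [(s & Hs & ->) Hf]; apply is_series_Reals in Hs.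
    apply (is_series_ext _ _ _ Hterm) in Hs.
    repeat split.
    + exists s; exact Hs.
    + unfold weighted_norm; now rewrite (is_series_unique _ _ Hs).
    + intros z; apply series_C_is_series, Hf.
  - intros (Ha & -> & Hf); split.
    + exists (Series (fun n => (Cmod (a n) * beta n) ^ 2)); split; [|reflexivity].
      apply is_series_Reals; apply (is_series_ext _ _ _ (fun n => eq_sym (Hterm n))).
      now apply Series_correct.
    + intros z; apply series_C_is_series, Hf.
Qed.

(* The squared norm of the reproducing kernel at any point of real part x. *)
Definition kernel (x : R) : R := Series (fun n => (exp (- lam n * x) / beta n) ^ 2).

Lemma ex_series_kernel (x : R) : ex_series (fun n => (exp (- lam n * x) / beta n) ^ 2).
Proof.
  destruct lam_ok as (Hlam0 & _ & _ & K & N1 & HK), beta_E as [Hbeta HE].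
  destruct (HE (K - x)) as [N2 HN2].
  set (N := S (N1 + N2)).
  apply (ex_series_incr_n _ N).
  apply @ex_series_le with (b := fun k => / INR (S (N + k)) ^ 2);
    [|apply (ex_series_incr_n (fun n => / INR (S n) ^ 2) N), ex_series_inv_sqr].
  intros k; set (n := (N + k)%nat).
  change (Rabs ((exp (- lam n * x) / beta n) ^ 2) <= / INR (S n) ^ 2).
  rewrite Rabs_pos_eq by apply pow2_ge_0.
  assert (Hlam : 0 < lam n) by (pose proof (lam_increasing 0 n ltac:(lia)); lra).
  assert (Hn : 0 < INR (S n)) by (apply lt_0_INR; lia).
  specialize (HK n ltac:(lia)); specialize (HN2 n ltac:(lia)).
  apply Rle_div_l in HK; [|assumption].
  apply Rle_div_r in HN2; [|assumption].
  rewrite <- (exp_ln (beta n)), <- (exp_ln (INR (S n))) by auto.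
  unfold Rdiv; rewrite <- exp_Ropp, <- exp_plus, !exp_sqr, <- exp_Ropp.
  apply exp_le; nra.
Qed.

Lemma kernel_pos (x : R) : 0 < kernel x.
Proof.
  unfold kernel; rewrite Series_incr_1 by apply ex_series_kernel.
  apply Rplus_lt_le_0_compat.
  - apply pow_lt, Rdiv_lt_0_compat; [apply exp_pos | apply beta_pos].
  - apply Series_nonneg; [intros n; apply pow2_ge_0|].
    apply (ex_series_incr_1 (fun n => (exp (- lam n * x) / beta n) ^ 2)), ex_series_kernel.
Qed.

Lemma kernel_shift_ge (x h : R) : 0 <= h -> exp (2 * lam 0%nat * h) * kernel x <= kernel (x - h).
Proof.
  intros Hh; unfold kernel; rewrite <- Series_scal_l.
  apply Series_le; [|apply ex_series_kernel].
  intros n; split; [apply Rmult_le_pos; [left; apply exp_pos | apply pow2_ge_0]|].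
  replace (exp (- lam n * (x - h)) / beta n)
    with (exp (lam n * h) * (exp (- lam n * x) / beta n))
    by (unfold Rdiv; rewrite <- Rmult_assoc, <- exp_plus; do 2 f_equal; ring).
  rewrite (Rpow_mult_distr (exp (lam n * h))), exp_sqr.
  apply Rmult_le_compat_r; [apply pow2_ge_0|].
  apply exp_le; pose proof (lam_0_le n); nra.
Qed.

Lemma weight_cancel (a : nat -> C) (x : R) (n : nat) :
  (Cmod (a n) * beta n) * (exp (- lam n * x) / beta n) = Cmod (a n) * exp (- lam n * x).
Proof. pose proof (beta_pos n); field; lra. Qed.

Lemma weighted_l2_ex_series (a : nat -> C) (x : R) :
  weighted_l2 a -> ex_series (fun n => Cmod (a n) * exp (- lam n * x)).
Proof.
  intros Ha; apply (ex_series_ext _ _ (weight_cancel a x)).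
  apply ex_series_mult_of_sqr; [exact Ha | apply ex_series_kernel].
Qed.

Lemma weighted_l2_summable (a : nat -> C) : weighted_l2 a -> ex_series (fun n => Cmod (a n)).
Proof.
  intros Ha; generalize (weighted_l2_ex_series a 0 Ha); apply ex_series_ext.
  intros n; rewrite Rmult_0_r, exp_0; apply Rmult_1_r.
Qed.

Lemma InH_eval_le (f : C -> C) (a : nat -> C) (r : R) (z : C) :
  InH lam beta f a r -> Cmod (f z) ^ 2 <= r ^ 2 * kernel (Re z).
Proof.
  intros (Ha & -> & Hf)%InH_iff.
  assert (Hle : Cmod (f z) <= Series (fun n => Cmod (a n) * exp (- lam n * Re z))).
  { apply (norm_is_series_le _ _ _ _ (Hf z)
      (Series_correct _ (weighted_l2_ex_series a (Re z) Ha))).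
    intros n; change norm with Cmod; rewrite Cmod_mult, Cmod_Cexp_neg; apply Rle_refl. }
  rewrite weighted_norm_sqr by assumption.
  eapply Rle_trans; [apply pow_incr; split; [apply Cmod_ge_0 | exact Hle]|].
  rewrite <- (Series_ext _ _ (weight_cancel a (Re z))).
  apply Series_cauchy_schwarz; [exact Ha | apply ex_series_kernel].
Qed.

Lemma InH_unique (f : C -> C) (a c : nat -> C) (r s : R) :
  InH lam beta f a r -> InH lam beta f c s -> (forall n, a n = c n) /\ r = s.
Proof.
  intros (Ha & -> & Hfa)%InH_iff (Hc & -> & Hfc)%InH_iff.
  assert (Heq : forall n, a n = c n).
  { intros n; apply (dirichlet_unique lam lam_inj a c f n);
      auto using weighted_l2_summable. }
  split; [exact Heq|].
  unfold weighted_norm; f_equal; apply Series_ext; intros n; now rewrite Heq.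
Qed.

Lemma InH_ext (f g : C -> C) (a : nat -> C) (r : R) :
  (forall z, f z = g z) -> InH lam beta f a r -> InH lam beta g a r.
Proof. intros Hfg [Hr Hf]; split; [exact Hr | intros z; rewrite <- Hfg; apply Hf]. Qed.

Lemma InH_monomial (m : nat) (k : C) :
  InH lam beta (monomial lam m k) (monomial_coeff m k) (Cmod k * beta m).
Proof.
  assert (Hnorm : is_series (fun n => (Cmod (monomial_coeff m k n) * beta n) ^ 2)
                            ((Cmod k * beta m) ^ 2)).
  { apply is_series_single with m; [now rewrite monomial_coeff_eq|].
    intros n Hn; rewrite monomial_coeff_neq, Cmod_0 by assumption.
    change ((0 * beta n) ^ 2 = 0); ring. }
  apply InH_iff; repeat split.
  - eexists; exact Hnorm.
  - unfold weighted_norm; rewrite (is_series_unique _ _ Hnorm), sqrt_pow2; [reflexivity|].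
    apply Rmult_le_pos; [apply Cmod_ge_0 | left; apply beta_pos].
  - apply dirichlet_monomial.
Qed.

Definition kernel_coeff (w : C) (n : nat) : C :=
  (Cconj (Cexp_neg (lam n) w) * (/ beta n ^ 2)%R)%C.

Definition kernel_fun (w z : C) : C :=
  Cseries (fun n => kernel_coeff w n * Cexp_neg (lam n) z)%C.

Lemma InH_kernel_fun (w : C) :
  InH lam beta (kernel_fun w) (kernel_coeff w) (sqrt (kernel (Re w))).
Proof.
  assert (Hterm : forall n,
    (exp (- lam n * Re w) / beta n) ^ 2 = (Cmod (kernel_coeff w n) * beta n) ^ 2).
  { intros n; pose proof (beta_pos n) as Hb; unfold kernel_coeff.
    rewrite Cmod_mult, Cmod_conj, Cmod_Cexp_neg, Cmod_R, Rabs_pos_eq;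
      [field; lra | left; apply Rinv_0_lt_compat, pow_lt; assumption]. }
  assert (Hl2 : weighted_l2 (kernel_coeff w))
    by (apply (ex_series_ext _ _ Hterm), ex_series_kernel).
  apply InH_iff; repeat split.
  - exact Hl2.
  - unfold weighted_norm, kernel; f_equal; now apply Series_ext.
  - intros z; apply Cseries_correct.
    generalize (weighted_l2_ex_series _ (Re z) Hl2); apply ex_series_ext.
    intros n; now rewrite Cmod_mult, Cmod_Cexp_neg.
Qed.

Lemma Re_kernel_fun_diag (w : C) : Re (kernel_fun w w) = kernel (Re w).
Proof.
  apply Series_ext; intros n; unfold kernel_coeff.
  replace (_ * _)%C with (Cexp_neg (lam n) w * Cconj (Cexp_neg (lam n) w) * (/ beta n ^ 2)%R)%C
    by ring.
  rewrite <- Cmod2_conj, re_scal_r, Cmod_Cexp_neg.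
  pose proof (beta_pos n); simpl; field; lra.
Qed.

Definition comp_norm_le (phi : C -> C) (M : R) : Prop :=
  forall (f : C -> C) (a : nat -> C) (r : R), InH lam beta f a r ->
    exists (c : nat -> C) (r' : R), InH lam beta (comp f phi) c r' /\ r' <= M * r.

Lemma InH_norm_nonneg (f : C -> C) (a : nat -> C) (r : R) : InH lam beta f a r -> 0 <= r.
Proof. intros [(s & _ & ->) _]; apply sqrt_pos. Qed.

(* Evaluate the kernel function of [phi w], composed with [phi], at [w]. *)
Lemma kernel_comp_le (phi : C -> C) (M : R) (w : C) :
  comp_norm_le phi M -> kernel (Re (phi w)) <= M ^ 2 * kernel (Re w).
Proof.
  intros HM.
  set (p := kernel (Re (phi w))).
  assert (Hp : 0 < p) by apply kernel_pos.
  destruct (HM _ _ _ (InH_kernel_fun (phi w))) as (c & r & Hc & Hr); fold p in Hr.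
  assert (Heval : p <= Cmod (kernel_fun (phi w) (phi w))).
  { unfold p; rewrite <- Re_kernel_fun_diag.
    eapply Rle_trans; [apply Rle_abs | apply re_le_Cmod]. }
  pose proof (InH_eval_le _ _ _ w Hc) as Hbound; unfold comp in Hbound.
  assert (Hr2 : r ^ 2 <= M ^ 2 * p).
  { rewrite <- (pow2_sqrt p), <- Rpow_mult_distr by lra.
    apply pow_incr; split; [exact (InH_norm_nonneg _ _ _ Hc) | exact Hr]. }
  apply Rmult_le_reg_l with p; [exact Hp|].
  pose proof (kernel_pos (Re w)); nra.
Qed.

Lemma Re_comp_ge (phi : C -> C) (M : R) (w : C) :
  0 < lam 0%nat -> comp_norm_le phi M -> Re w - M ^ 2 / (2 * lam 0%nat) <= Re (phi w).
Proof.
  intros Hlam HM.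
  set (h := Re w - Re (phi w)).
  assert (0 <= M ^ 2 / (2 * lam 0%nat)) by (apply Rdiv_le_0_compat; [apply pow2_ge_0 | lra]).
  destruct (Rle_or_lt h 0) as [Hh|Hh]; [unfold h in Hh; lra|].
  assert (Hle : exp (2 * lam 0%nat * h) * kernel (Re w) <= M ^ 2 * kernel (Re w)).
  { eapply Rle_trans; [apply kernel_shift_ge; lra|].
    replace (Re w - h) with (Re (phi w)) by (unfold h; ring).
    now apply kernel_comp_le. }
  apply Rmult_le_reg_r in Hle; [|apply kernel_pos].
  assert (Hgap : h <= M ^ 2 / (2 * lam 0%nat)).
  { apply Rle_div_r; [lra|]; pose proof (exp_ineq1_le (2 * lam 0%nat * h)); lra. }
  unfold h in Hgap; lra.
Qed.

(* By the kernel estimate e^{-lam_0 phi} grows at most like e^{-lam_0 Re z}, so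
   its Dirichlet series is reduced to its first term. *)
Lemma Cexp_neg_comp_eq (phi : C -> C) (M : R) :
  0 < lam 0%nat -> comp_norm_le phi M ->
  exists k : C, forall z, Cexp_neg (lam 0%nat) (phi z) = (k * Cexp_neg (lam 0%nat) z)%C :> C.
Proof.
  intros Hlam HM; set (h := M ^ 2 / (2 * lam 0%nat)).
  destruct (HM _ _ _ (InH_monomial 0 1)) as (c & r & (Hl2 & _ & Hc)%InH_iff & _).
  assert (Hcomp : forall z, comp (monomial lam 0 1) phi z = Cexp_neg (lam 0%nat) (phi z))
    by (intros z; apply Cmult_1_l).
  assert (Hzero : forall n, n <> 0%nat -> c n = 0).
  { intros n Hn.
    apply (dirichlet_liouville lam lam_inj c _ n (lam 0%nat) (lam 0%nat * h) Hc).
    - intros x; now apply weighted_l2_ex_series.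
    - intros z; rewrite Hcomp, Cmod_Cexp_neg; apply exp_le.
      pose proof (Re_comp_ge phi M z Hlam HM) as Hre; fold h in Hre; nra.
    - apply lam_increasing; lia. }
  exists (c 0%nat); intros z; rewrite <- Hcomp.
  apply (is_series_inj _ _ _ (Hc z)).
  apply is_series_single with 0%nat; [reflexivity|].
  intros n Hn; rewrite Hzero by assumption; apply Cmult_0_l.
Qed.

Section Translation.

Variables (phi : C -> C) (b : C).
Hypothesis phi_eq : forall z, phi z = (z + b)%C.

Lemma InH_comp_translation (f : C -> C) (a : nat -> C) (r : R) :
  0 <= Re b -> InH lam beta f a r ->
  exists r', InH lam beta (comp f phi) (fun n => a n * Cexp_neg (lam n) b)%C r' /\
    r' <= exp (- lam 0%nat * Re b) * r.
Proof.
  intros Hb (Ha & -> & Hf)%InH_iff.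
  set (E := exp (- lam 0%nat * Re b)).
  assert (HE : 0 < E) by apply exp_pos.
  assert (Hterm : forall n, 0 <= (Cmod (a n * Cexp_neg (lam n) b) * beta n) ^ 2
                            <= E ^ 2 * (Cmod (a n) * beta n) ^ 2).
  { intros n; split; [apply pow2_ge_0|]; pose proof (beta_pos n).
    rewrite <- Rpow_mult_distr, Cmod_mult, Cmod_Cexp_neg.
    assert (exp (- lam n * Re b) <= E) by (apply exp_le; pose proof (lam_0_le n); nra).
    pose proof (exp_pos (- lam n * Re b)); pose proof (Cmod_ge_0 (a n)).
    assert (0 <= Cmod (a n) * beta n) by nra.
    apply pow_incr; split; [apply Rmult_le_pos; nra|].
    rewrite (Rmult_comm (Cmod (a n)) (exp _)), Rmult_assoc; now apply Rmult_le_compat_r. }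
  assert (HEa : ex_series (fun n => E ^ 2 * (Cmod (a n) * beta n) ^ 2))
    by exact (ex_series_scal (E ^ 2) _ Ha).
  exists (weighted_norm (fun n => a n * Cexp_neg (lam n) b)%C); split.
  - apply InH_iff; repeat split.
    + apply @ex_series_le with (2 := HEa); intros n; change norm with Rabs.
      rewrite Rabs_pos_eq by apply Hterm; apply Hterm.
    + apply (dirichlet_ext _ _ _ _ _ (fun n => eq_refl)) with (2 := dirichlet_shift lam a f b Hf).
      intros z; unfold comp; now rewrite phi_eq.
  - unfold weighted_norm; rewrite <- (sqrt_pow2 E), <- sqrt_mult_alt by nra.
    apply sqrt_le_1_alt; rewrite <- Series_scal_l; now apply Series_le.
Qed.

Lemma InH_comp_monomial (m : nat) (k : C) :
  InH lam beta (comp (monomial lam m k) phi) (monomial_coeff m (k * Cexp_neg (lam m) b))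
    (exp (- lam m * Re b) * (Cmod k * beta m)).
Proof.
  replace (exp (- lam m * Re b) * (Cmod k * beta m))
    with (Cmod (k * Cexp_neg (lam m) b) * beta m)
    by (rewrite Cmod_mult, Cmod_Cexp_neg; ring).
  apply InH_ext with (2 := InH_monomial m (k * Cexp_neg (lam m) b)).
  intros z; unfold comp, monomial; rewrite phi_eq, Cexp_neg_plus; ring.
Qed.

Lemma translation_Re_nonneg (M : R) : comp_norm_le phi M -> 0 <= Re b.
Proof.
  intros HM; destruct (Rle_or_lt 0 (Re b)) as [|Hneg]; [assumption|exfalso].
  assert (Hexp : forall n, exp (- lam n * Re b) <= M).
  { intros n; destruct (HM _ _ _ (InH_monomial n 1)) as (c & r & Hc & Hr).
    destruct (InH_unique _ _ _ _ _ Hc (InH_comp_monomial n 1)) as [_ ->].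
    pose proof (beta_pos n); rewrite Cmod_1, Rmult_1_l in Hr.
    now apply Rmult_le_reg_r in Hr. }
  destruct lam_ok as (_ & _ & Hinf & _).
  destruct (Hinf (M / - Re b)) as [N HN]; specialize (HN N (le_n N)); specialize (Hexp N).
  apply Rlt_div_l in HN; [|lra].
  pose proof (exp_ineq1_le (- lam N * Re b)); lra.
Qed.

Lemma is_lub_opnorm_translation :
  0 <= Re b -> is_lub (opnorm_set lam beta phi) (exp (- lam 0%nat * Re b)).
Proof.
  intros Hb; pose proof (exp_pos (- lam 0%nat * Re b)); split.
  - intros t (f & a & r & c & Hf & Hr & Hc).
    destruct (InH_comp_translation f a r Hb Hf) as (t' & Ht' & Hle).
    destruct (InH_unique _ _ _ _ _ Hc Ht') as [_ ->]; nra.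
  - intros B HB; apply HB.
    pose proof (beta_pos 0) as Hbeta.
    set (k := RtoC (/ beta 0%nat)).
    assert (Hk : Cmod k * beta 0%nat = 1).
    { unfold k; rewrite Cmod_R, Rabs_pos_eq by (left; now apply Rinv_0_lt_compat).
      field; lra. }
    pose proof (InH_monomial 0 k) as Hmono; pose proof (InH_comp_monomial 0 k) as Hcomp.
    rewrite Hk in Hmono, Hcomp; rewrite Rmult_1_r in Hcomp.
    do 4 eexists; exact (conj Hmono (conj (Rle_refl 1) Hcomp)).
Qed.

End Translation.

End WeightedSpace.

Definition Cderivable_pt_lim (f : C -> C) (z L : C) : Prop :=
  forall eps, 0 < eps -> exists delta, 0 < delta /\
    forall h : C, 0 < Cmod h < delta -> Cmod (f (z + h) - f z - L * h)%C <= eps * Cmod h.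

Lemma entire_Cderivable (f : C -> C) (z : C) : entire f -> exists L : C, Cderivable_pt_lim f z L.
Proof. intros Hf; exact (Hf z). Qed.

Lemma entire_minus_id (f : C -> C) : entire f -> entire (fun z => f z - z)%C.
Proof.
  intros Hf z; destruct (entire_Cderivable f z Hf) as [L HL]; exists (L - 1)%C.
  change (Cderivable_pt_lim (fun u => f u - u)%C z (L - 1)%C).
  intros eps Heps; destruct (HL eps Heps) as (delta & Hdelta & Hh).
  exists delta; split; [exact Hdelta|]; intros h Hlt.
  replace (f (z + h) - (z + h) - (f z - z) - (L - 1) * h)%C
    with (f (z + h) - f z - L * h)%C by ring.
  now apply Hh.
Qed.

(* Along h = t conj(L) the increment of f is purely imaginary, while L h = t |L|^2 is real. *)
Lemma Cderivable_pt_lim_Re_const (f : C -> C) (z L : C) :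
  (forall w, Re (f w) = Re (f z)) -> Cderivable_pt_lim f z L -> L = 0.
Proof.
  intros Hre Hf; apply Cmod_eq_0.
  destruct (Cmod_ge_0 L) as [Hpos|]; [exfalso|now symmetry].
  destruct (Hf (Cmod L / 2) ltac:(lra)) as (delta & Hdelta & Hh).
  set (t := delta / (2 * Cmod L)).
  assert (Ht : t * Cmod L = delta / 2) by (unfold t; field; lra).
  assert (Htpos : 0 < t) by (apply Rdiv_lt_0_compat; lra).
  assert (Hmod : Cmod (t * Cconj L) = delta / 2)
    by (now rewrite Cmod_mult, Cmod_R, Cmod_conj, Rabs_pos_eq by lra).
  specialize (Hh (t * Cconj L)%C ltac:(rewrite Hmod; lra)); rewrite Hmod in Hh.
  set (diff := (f (z + t * Cconj L) - f z - L * (t * Cconj L))%C) in Hh.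
  assert (Hre_diff : Re diff = - (t * Cmod L ^ 2)).
  { unfold diff; replace (L * (t * Cconj L))%C with (RtoC (t * Cmod L ^ 2))
      by (rewrite RtoC_mult, Cmod2_conj; ring).
    unfold Cminus; rewrite !re_plus, !re_opp, Hre, re_RtoC; ring. }
  pose proof (re_le_Cmod diff) as Hle; rewrite Hre_diff, Rabs_Ropp in Hle.
  pose proof (Rle_abs (t * Cmod L ^ 2)); nra.
Qed.

Lemma is_derive_Im_line (f : C -> C) (z : C) (t : R) :
  Cderivable_pt_lim f (t * z) 0 -> is_derive (fun s : R => Im (f (s * z)%C)) t 0.
Proof.
  intros Hf; destruct (Ceq_dec z 0) as [->|Hz%Cmod_gt_0].
  { apply is_derive_ext with (fun _ => Im (f 0)); [|exact (is_derive_const (Im (f 0)) t)].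
    intros s; now rewrite Cmult_0_r. }
  apply is_derive_Reals; intros eps Heps.
  destruct (Hf (eps / (2 * Cmod z))) as (delta & Hdelta & Hh);
    [apply Rdiv_lt_0_compat; lra|].
  assert (Hpos : 0 < delta / Cmod z) by now apply Rdiv_lt_0_compat.
  exists (mkposreal _ Hpos); intros s Hs Hlt; simpl in Hlt; apply Rlt_div_r in Hlt; [|exact Hz].
  apply Rabs_pos_lt in Hs.
  assert (Hmod : Cmod (s * z) = Rabs s * Cmod z) by now rewrite Cmod_mult, Cmod_R.
  specialize (Hh (s * z)%C ltac:(rewrite Hmod; split; [now apply Rmult_lt_0_compat | lra])).
  replace (t * z + s * z)%C with ((t + s)%R * z)%C in Hh by (rewrite RtoC_plus; ring).
  rewrite Hmod in Hh.
  replace (eps / (2 * Cmod z) * (Rabs s * Cmod z)) with (eps / 2 * Rabs s) in Hh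
    by (field; lra).
  rewrite Rminus_0_r, Rabs_div by (intros ->; rewrite Rabs_R0 in Hs; lra).
  apply Rlt_div_l; [exact Hs|].
  set (diff := (_ - _ - 0 * (s * z))%C) in Hh.
  replace (Im _ - Im _) with (Im diff)
    by (unfold diff, Cminus; rewrite Cmult_0_l, !im_plus, !im_opp, im_RtoC; ring).
  pose proof (Rle_trans _ _ _ (Rmax_r _ _) (Rmax_Cmod diff)) as Him; fold (Im diff) in Him.
  nra.
Qed.

Lemma entire_Re_const (f : C -> C) (z : C) :
  entire f -> (forall u v, Re (f u) = Re (f v)) -> f z = f 0.
Proof.
  intros Hf Hre.
  assert (Hderive : forall t : R, is_derive (fun s : R => Im (f (s * z)%C)) t 0).
  { intros t; apply is_derive_Im_line.
    destruct (entire_Cderivable f (t * z)%C Hf) as [L HL].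
    now rewrite (Cderivable_pt_lim_Re_const _ _ _ (fun w => Hre w _) HL) in HL. }
  apply injective_projections; [apply Hre|].
  pose proof (eq_is_derive (fun t : R => Im (f (t * z)%C)) 0 1
    (fun t _ => Hderive t) Rlt_0_1) as Heq.
  cbv beta in Heq; rewrite Cmult_0_l, Cmult_1_l in Heq; now symmetry.
Qed.

Lemma translation_of_Cexp_neg_comp (phi : C -> C) (l : R) (k : C) :
  0 < l -> entire phi -> (forall z, Cexp_neg l (phi z) = (k * Cexp_neg l z)%C :> C) ->
  forall z, phi z = (z + phi 0)%C.
Proof.
  intros Hl Hphi Hk z.
  assert (Hmod : forall u, exp (- l * Re (phi u - u)%C) = Cmod k).
  { intros u; pose proof (f_equal Cmod (Hk u)) as Hu.
    rewrite Cmod_mult, !Cmod_Cexp_neg in Hu.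
    unfold Cminus; rewrite re_plus, re_opp, Rmult_plus_distr_l, exp_plus, Hu.
    rewrite Rmult_assoc, <- exp_plus.
    replace (- l * Re u + - l * - Re u) with 0 by ring; rewrite exp_0; ring. }
  assert (Heq : (phi z - z = phi 0 - 0)%C).
  { apply (entire_Re_const (fun u => phi u - u)%C z).
    - now apply entire_minus_id.
    - intros u v; apply Rmult_eq_reg_l with (- l); [|lra].
      apply exp_inv; now rewrite !Hmod. }
  replace (phi z) with (phi z - z + z)%C by ring; rewrite Heq; ring.
Qed.

Lemma bounded_comp_iff (lam beta : nat -> R) (phi : C -> C) :
  Lambda_ok lam -> 0 < lam 0%nat -> CondE lam beta -> entire phi ->
  bounded_comp lam beta phi <->
    exists b : C, 0 <= Re b /\ forall z : C, phi z = (z + b)%C.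
Proof.
  intros Hlam Hlam0 HE Hphi; split.
  - intros [M HM].
    destruct (Cexp_neg_comp_eq lam beta Hlam HE phi M Hlam0 HM) as [k Hk].
    pose proof (translation_of_Cexp_neg_comp phi _ k Hlam0 Hphi Hk) as Htr.
    exists (phi 0); split; [|exact Htr].
    exact (translation_Re_nonneg lam beta Hlam HE phi _ Htr M HM).
  - intros (b & Hb & Htr); exists (exp (- lam 0%nat * Re b)); intros f a r Hf.
    destruct (InH_comp_translation lam beta Hlam HE phi b Htr f a r Hb Hf) as (r' & Hr').
    eexists; exists r'; exact Hr'.
Qed.

Import Defs.

Theorem theorem4p5 (lam beta : nat -> R) (phi : Cplx -> Cplx) :
  Lambda_ok lam -> 0 < lam 0%nat -> CondE lam beta -> entire phi ->
  (bounded_comp lam beta phi <->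
     exists b : Cplx, 0 <= Re b /\ forall z : Cplx, phi z = Cadd z b) /\
  (forall b : Cplx, 0 <= Re b -> (forall z : Cplx, phi z = Cadd z b) ->
     is_lub (opnorm_set lam beta phi) (exp (- lam 0%nat * Re b))).
Proof.
  intros Hlam Hlam0 HE Hphi; split.
  - exact (bounded_comp_iff lam beta phi Hlam Hlam0 HE Hphi).
  - intros b Hb Htr; exact (is_lub_opnorm_translation lam beta Hlam HE phi b Htr Hb).
Qed.
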